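(* For each $\delta\in\mathbb R$ let $\mathrm U(n,1;\Lambda_\delta)$ be the unitary group of signature $(n,1)$ over $\Lambda_\delta$, and let $\mathrm{USt}(n,1;\Lambda_\delta)=\left(\begin{smallmatrix}\mathrm U(n;\Lambda_\delta)&0\\0&\mathrm U(\Lambda_\delta)\end{smallmatrix}\right)$ be the stabilizer of a point in $\mathbb H^n_{\Lambda_\delta}$. Then the maps $\mathbb R\to\mathfrak C(\mathrm{GL}(2n+2;\mathbb R))$ defined by $$\delta\mapsto\iota_\delta(\mathrm U(n,1;\Lambda_\delta)),\qquad \delta\mapsto\iota_\delta(\mathrm{USt}(n,1;\Lambda_\delta))$$ are continuous into the Chabauty space $\mathfrak C(\mathrm{GL}(2n+2;\mathbb R))$.
   Context: For $\delta\in\mathbb R$, $\Lambda_\delta=\mathbb R[\lambda]/(\lambda^2=\delta)$ with conjugation $\overline{a+\lambda b}=a-\lambda b$. For matrices over $\Lambda_\delta$, $A^\dagger=\overline A^{\,T}$. With $Q=\mathrm{diag}(I_n,-1)$, $\mathrm U(n,1;\Lambda_\delta)=\{A\in\mathrm M(n+1;\Lambda_\delta):A^\dagger QA=Q\}$, $\mathrm U(n;\Lambda_\delta)=\{A\in\mathrm M(n;\Lambda_\delta): A^\dagger A=I_n\}$ and $\mathrm U(\Lambda_\delta)=\{u\in\Lambda_\delta:u\overline u=1\}$. $\mathbb H^n_{\Lambda_\delta}$ is the homogeneous geometry given by $\mathrm U(n,1;\Lambda_\delta)$ acting on $\{z\in\Lambda_\delta^{n+1}: z^TQ\overline z=-1\}/\mathrm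 U(\Lambda_\delta)$; the stabilizer in question is that of the class of $e_{n+1}=(0,\dots,0,1)$. The representation $\iota_\delta\colon\mathrm M(m;\Lambda_\delta)\to\mathrm M(2m;\mathbb R)$ replaces each entry $a+\lambda b$ by the $2\times2$ block $\left(\begin{smallmatrix}a&\delta b\\ b&a\end{smallmatrix}\right)$; here $m=n+1$. $\mathfrak C(G)$ denotes the space of closed subgroups of $G$ with the Chabauty topology. *)

(* Defs.v *)
From HB Require Import structures.
From mathcomp Require Import all_boot all_order all_algebra.
From mathcomp Require Import all_classical all_reals all_analysis.
From mathcomp Require Import ring zify.

Set Implicit Arguments.
Unset Strict Implicit.
Unset Printing Implicit Defensive.

Import GRing.Theory numFieldNormedType.Exports.

Local Open Scope classical_set_scope.
Local Open Scope ring_scope.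

(** * The Chabauty space of closed subgroups *)

(* No compatibility between the group law and the topology is required: the
   definition of the Chabauty space does not use it. *)
#[short(type="topGroupBaseType")]
HB.structure Definition TopGroupBase := {G of Group G & Topological G}.

Section Chabauty.
Variable G : topGroupBaseType.

Record chabauty := Chabauty {
  chabauty_set :> set G;
  chabauty_closed : closed chabauty_set;
  chabauty_group : group_closed (mem chabauty_set) }.

HB.instance Definition _ := gen_eqMixin chabauty.
HB.instance Definition _ := gen_choiceMixin chabauty.

(* The sets of closed subgroups meeting a given open set, and those missing a
   given compact set. *)
Definition chabauty_subbase : set (set chabauty) :=
  [set [set H : chabauty | H `&` U !=set0] | U in open] `|`
  [set [set H : chabauty | H `&` K = set0] | K in compact].

HB.instance Definition _ :=
  isSubBaseTopological.Build chabauty chabauty_subbase id.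

End Chabauty.

(** * The general linear group *)

Section GL.
Variables (R : realType) (m : nat).

Definition GL : Type := set_type [set A : 'M[R]_m | A \in unitmx].

HB.instance Definition _ :=
  Topological.copy GL (set_type [set A : 'M[R]_m | A \in unitmx]).

Definition GLval (g : GL) : 'M[R]_m := \val g.

Lemma GLvalP (g : GL) : GLval g \in unitmx.
Proof. exact: set_valP g. Qed.

Definition mkGL (A : 'M[R]_m) (Au : A \in unitmx) : GL :=
  exist _ A (mem_set (Au : [set A : 'M[R]_m | A \in unitmx] A)).

Lemma GLval_inj : injective GLval. Proof. exact: val_inj. Qed.

Lemma GL_mul_unit (g h : GL) : GLval g *m GLval h \in unitmx.
Proof. by rewrite unitmx_mul !GLvalP. Qed.

Lemma GL_inv_unit (g : GL) : invmx (GLval g) \in unitmx.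
Proof. by rewrite unitmx_inv GLvalP. Qed.

Definition GL_one : GL := mkGL (unitmx1 R m).
Definition GL_mul (g h : GL) : GL := mkGL (GL_mul_unit g h).
Definition GL_inv (g : GL) : GL := mkGL (GL_inv_unit g).

Lemma GL_mulA : associative GL_mul.
Proof. by move=> f g h; apply: GLval_inj; rewrite /GLval /= mulmxA. Qed.
Lemma GL_mul1g : left_id GL_one GL_mul.
Proof. by move=> g; apply: GLval_inj; rewrite /GLval /= mul1mx. Qed.
Lemma GL_mulg1 : right_id GL_one GL_mul.
Proof. by move=> g; apply: GLval_inj; rewrite /GLval /= mulmx1. Qed.
Lemma GL_mulVg : left_inverse GL_one GL_inv GL_mul.
Proof. by move=> g; apply: GLval_inj; exact: mulVmx (GLvalP g). Qed.
Lemma GL_mulgV : right_inverse GL_one GL_inv GL_mul.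
Proof. by move=> g; apply: GLval_inj; exact: mulmxV (GLvalP g). Qed.

HB.instance Definition _ :=
  isGroup.Build GL GL_mulA GL_mul1g GL_mulg1 GL_mulVg GL_mulgV.

Lemma GLval_continuous : continuous GLval.
Proof. exact: initial_continuous. Qed.

End GL.

(** * The algebras R[lambda]/(lambda^2 = delta) *)

Notation Lambda delta := {poly %/ ('X^2 - delta%:P)}.

Section Lambda.
Variables (R : realType) (delta : R).
Implicit Types u v : Lambda delta.

(* u = Re u + lambda Im u, with lambda = 'qX, the class of 'X *)
Definition Re u : R := (u : {poly R})`_0.
Definition Im u : R := (u : {poly R})`_1.

Definition lconj u : Lambda delta := Re u *: 1 - Im u *: 'qX.

Lemma mk_monic_lambda : mk_monic ('X^2 - delta%:P) = 'X^2 - delta%:P.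
Proof. by rewrite /mk_monic size_XnsubC // monicXnsubC. Qed.

Lemma lambda_size u : (size (u : {poly R}) <= 2)%N.
Proof.
rewrite -ltnS; apply: leq_trans (size_mk_monic u) _.
by rewrite mk_monic_lambda size_XnsubC.
Qed.

Lemma lambda_polyE u : (u : {poly R}) = (Re u)%:P + Im u *: 'X.
Proof.
apply/polyP => i; rewrite coefD coefC coefZ coefX.
case: i => [|[|i]] /=; rewrite ?mulr0 ?mulr1 ?addr0 ?add0r //.
by rewrite nth_default // (leq_trans (lambda_size u)).
Qed.

Lemma lambda_inj u v : Re u = Re v -> Im u = Im v -> u = v.
Proof. by move=> e0 e1; apply: val_inj; rewrite /= !lambda_polyE e0 e1. Qed.

Lemma qX_polyE : ('qX : Lambda delta) = 'X :> {poly R}.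
Proof. by rewrite qpolyXE ?size_XnsubC // monicXnsubC. Qed.

Lemma ReD u v : Re (u + v) = Re u + Re v. Proof. exact: coefD. Qed.
Lemma ImD u v : Im (u + v) = Im u + Im v. Proof. exact: coefD. Qed.
Lemma ReN u : Re (- u) = - Re u. Proof. exact: coefN. Qed.
Lemma ImN u : Im (- u) = - Im u. Proof. exact: coefN. Qed.
Lemma ReZ a u : Re (a *: u) = a * Re u. Proof. exact: coefZ. Qed.
Lemma ImZ a u : Im (a *: u) = a * Im u. Proof. exact: coefZ. Qed.
Lemma Re0 : Re 0 = 0. Proof. exact: coef0. Qed.
Lemma Im0 : Im 0 = 0. Proof. exact: coef0. Qed.
Lemma Re1 : Re 1 = 1. Proof. by rewrite /Re /= coefC. Qed.
Lemma Im1 : Im 1 = 0. Proof. by rewrite /Im /= coefC. Qed.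
Lemma RelX : Re 'qX = 0. Proof. by rewrite /Re qX_polyE coefX. Qed.
Lemma ImlX : Im 'qX = 1. Proof. by rewrite /Im qX_polyE coefX. Qed.

Lemma lambdaE u : u = Re u *: 1 + Im u *: 'qX.
Proof.
by apply: lambda_inj; rewrite ?ReD ?ImD ?ReZ ?ImZ ?Re1 ?Im1 ?RelX ?ImlX
  ?mulr1 ?mulr0 ?addr0 ?add0r.
Qed.

Lemma lambda_mulE u v :
  (u * v : Lambda delta) =
    (Re u * Re v + delta * (Im u * Im v))%:P +
    (Re u * Im v + Im u * Re v) *: 'X :> {poly R}.
Proof.
rewrite poly_of_qpolyM.
set r := RHS.
have -> : (u : {poly R}) * v = (Im u * Im v)%:P * ('X^2 - delta%:P) + r.
  rewrite /r [in LHS](lambda_polyE u) [in LHS](lambda_polyE v) -!mul_polyC.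
  by rewrite !rmorphD !rmorphM /=; ring.
rewrite {}/r; move: (Re u) (Im u) (Re v) (Im v) => a b c d.
rewrite mk_monic_lambda.
rewrite Pdiv.RingMonic.rmodp_addl_mul_small ?monicXnsubC //.
rewrite size_XnsubC // ltnS (leq_trans (size_polyD _ _)) // geq_max.
rewrite (leq_trans (size_polyC_leq1 _)) //=.
by rewrite (leq_trans (size_scale_leq _ _)) // size_polyX.
Qed.

Lemma ReM u v : Re (u * v) = Re u * Re v + delta * (Im u * Im v).
Proof. by rewrite {1}/Re lambda_mulE coefD coefC coefZ coefX mulr0 addr0. Qed.
Lemma ImM u v : Im (u * v) = Re u * Im v + Im u * Re v.
Proof. by rewrite {1}/Im lambda_mulE coefD coefC coefZ coefX mulr1 add0r. Qed.

Definition lambdaS := (ReD, ImD, ReN, ImN, ReZ, ImZ, Re0, Im0, Re1, Im1,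
  RelX, ImlX, ReM, ImM).

Lemma Re_conj u : Re (lconj u) = Re u.
Proof. by rewrite /lconj !lambdaS mulr1 mulr0 subr0. Qed.
Lemma Im_conj u : Im (lconj u) = - Im u.
Proof. by rewrite /lconj !lambdaS mulr1 mulr0 sub0r. Qed.

Lemma lconj_zmod_morphism : zmod_morphism lconj.
Proof.
by move=> u v; apply: lambda_inj; rewrite !(Re_conj, Im_conj, lambdaS) ?opprD.
Qed.

Lemma lconj_monoid_morphism : monoid_morphism lconj.
Proof.
split=> [|u v]; apply: lambda_inj; rewrite !(Re_conj, Im_conj, lambdaS) ?oppr0 //;
  by ring.
Qed.

HB.instance Definition _ :=
  GRing.isZmodMorphism.Build (Lambda delta) (Lambda delta) lconj
    lconj_zmod_morphism.
HB.instance Definition _ :=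
  GRing.isMonoidMorphism.Build (Lambda delta) (Lambda delta) lconj
    lconj_monoid_morphism.

Lemma lconjK : involutive lconj.
Proof. by move=> u; apply: lambda_inj; rewrite !(Re_conj, Im_conj) ?opprK. Qed.

Definition dagger m n (A : 'M[Lambda delta]_(m, n)) : 'M[Lambda delta]_(n, m) :=
  (map_mx lconj A)^T.

Lemma dagger_mul m n p (A : 'M[Lambda delta]_(m, n)) (B : 'M[Lambda delta]_(n, p)) :
  dagger (A *m B) = dagger B *m dagger A.
Proof. by rewrite /dagger map_mxM trmx_mul. Qed.

Lemma dagger1 n : dagger (1%:M : 'M[Lambda delta]_n) = 1%:M.
Proof. by rewrite /dagger map_mx1 trmx1. Qed.

Lemma daggerK m n (A : 'M[Lambda delta]_(m, n)) : dagger (dagger A) = A.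
Proof. by apply/matrixP => i j; rewrite !mxE lconjK. Qed.

(** * The unitary groups *)

Definition unitary1 : set (Lambda delta) := [set u | u * lconj u = 1].

Definition unitary n : set 'M[Lambda delta]_n :=
  [set A | dagger A *m A = 1%:M].
Arguments unitary n _ : clear implicits.

Definition Qform n : 'M[Lambda delta]_(n + 1) :=
  block_mx 1%:M 0 0 (- 1%:M).

Definition unitary_n1 n : set 'M[Lambda delta]_(n + 1) :=
  [set A | dagger A *m Qform n *m A = Qform n].

Definition USt n : set 'M[Lambda delta]_(n + 1) :=
  [set block_mx B 0 0 u%:M | B in unitary n & u in unitary1].

(** * The geometry *)

Definition hyperboloid n : set 'cV[Lambda delta]_(n + 1) :=
  [set z | z^T *m Qform n *m map_mx lconj z = - 1%:M].
Arguments hyperboloid n _ : clear implicits.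

Definition lclass n (z : 'cV[Lambda delta]_(n + 1)) :
  set 'cV[Lambda delta]_(n + 1) := [set u *: z | u in unitary1].

(* The points are the U(Lambda)-orbits in the hyperboloid. *)
Definition hyperbolic_space n : set (set 'cV[Lambda delta]_(n + 1)) :=
  [set lclass z | z in hyperboloid n].

Definition base_point n : set 'cV[Lambda delta]_(n + 1) :=
  lclass (col_mx 0 1%:M).

Definition stabilizer n (p : set 'cV[Lambda delta]_(n + 1)) :
  set 'M[Lambda delta]_(n + 1) :=
  [set A | unitary_n1 A /\ (mulmx A) @` p = p].

End Lambda.

Arguments unitary1 {R} delta.
Arguments unitary {R} delta n.
Arguments unitary_n1 {R} delta n.
Arguments USt {R} delta n.
Arguments hyperbolic_space {R} delta n.
Arguments base_point {R} delta n.

(** * The real representation *)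

Section Iota.
Variables (R : realType) (delta : R) (m : nat).

Lemma blk_subproof (p : 'I_(2 * m)) : (p./2 < m)%N.
Proof. by have := ltn_ord p; lia. Qed.

(* row and column p = 2 i + r of the image lie in the i-th block, at place r *)
Definition blk (p : 'I_(2 * m)) : 'I_m := Ordinal (blk_subproof p).

Definition iota_block (u : Lambda delta) : seq (seq R) :=
  [:: [:: Re u; delta * Im u];
      [:: Im u; Re u] ].

Definition iota (A : 'M[Lambda delta]_m) : 'M[R]_(2 * m) :=
  \matrix_(p, q)
    nth 0 (nth [::] (iota_block (A (blk p) (blk q))) (odd p)) (odd q).

Definition iota_image (S : set 'M[Lambda delta]_m) : set (GL R (2 * m)) :=
  [set g | (iota @` S) (GLval g)].

Lemma unblk_subproof (i : 'I_m) (b : bool) : (b + i.*2 < 2 * m)%N.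
Proof. by have := ltn_ord i; case: b => /=; lia. Qed.

Definition unblk (i : 'I_m) (b : bool) : 'I_(2 * m) :=
  Ordinal (unblk_subproof i b).

Lemma blkK p : unblk (blk p) (odd p) = p.
Proof. by apply: val_inj; rewrite /= odd_double_half. Qed.
Lemma unblkK i b : blk (unblk i b) = i.
Proof. by apply: val_inj; rewrite /= half_bit_double. Qed.
Lemma odd_unblk i (b : bool) : odd (unblk i b) = b.
Proof. by rewrite /= oddD odd_double addbF; case: b. Qed.

Lemma sum_blk (F : 'I_(2 * m) -> R) :
  \sum_p F p = \sum_i (F (unblk i false) + F (unblk i true)).
Proof.
rewrite (reindex (fun x : 'I_m * bool => unblk x.1 x.2)) /=; last first.
  exists (fun p => (blk p, odd p)) => [[i b] _|p _]; rewrite ?blkK //=.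
  by rewrite unblkK -[X in (_, X)]/(odd (unblk i b)) odd_unblk.
rewrite -(pair_bigA _ (fun i b => F (unblk i b))) /=.
by apply: eq_bigr => i _; rewrite big_bool addrC.
Qed.

Lemma iotaE A i j (b c : bool) : iota A (unblk i b) (unblk j c) =
  nth 0 (nth [::] (iota_block (A i j)) b) c.
Proof. by rewrite mxE !unblkK !odd_unblk. Qed.

Lemma unblk_matrixP (M N : 'M[R]_(2 * m)) :
  (forall i j b c, M (unblk i b) (unblk j c) = N (unblk i b) (unblk j c)) ->
  M = N.
Proof. by move=> e; apply/matrixP => p q; rewrite -(blkK p) -(blkK q). Qed.

Lemma Re_sum I (r : seq I) (F : I -> Lambda delta) :
  Re (\sum_(i <- r) F i) = \sum_(i <- r) Re (F i).
Proof. by apply: big_morph; [exact: ReD|exact: Re0]. Qed.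
Lemma Im_sum I (r : seq I) (F : I -> Lambda delta) :
  Im (\sum_(i <- r) F i) = \sum_(i <- r) Im (F i).
Proof. by apply: big_morph; [exact: ImD|exact: Im0]. Qed.

Lemma iotaM A B : iota (A *m B) = iota A *m iota B.
Proof.
apply: unblk_matrixP => i j b c; rewrite iotaE !mxE sum_blk /iota_block.
rewrite Re_sum Im_sum.
by case: b; case: c => /=; rewrite ?mulr_sumr; apply: eq_bigr => k _;
  rewrite !iotaE /= ReM || rewrite !iotaE /= ImM; ring.
Qed.

Lemma iota1 : iota 1%:M = 1%:M.
Proof.
apply: unblk_matrixP => i j b c; rewrite iotaE !mxE /iota_block.
have -> : (unblk i b == unblk j c) = (i == j) && (b == c).
  apply/eqP/andP => [e|[/eqP -> /eqP ->] //]; split; apply/eqP.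
    by rewrite -(unblkK i b) e unblkK.
  by rewrite -(odd_unblk i b) e odd_unblk.
by case: eqP => _; case: b; case: c; rewrite /= ?mulr1n ?mulr0n ?lambdaS ?mulr0.
Qed.

Definition iota_inv (M : 'M[R]_(2 * m)) : 'M[Lambda delta]_m :=
  \matrix_(i, j) (M (unblk i false) (unblk j false) *: 1 +
                  M (unblk i true) (unblk j false) *: 'qX).

Lemma iotaK : cancel iota iota_inv.
Proof.
by move=> A; apply/matrixP => i j; rewrite mxE !iotaE /= -lambdaE.
Qed.

(* No element of S is lost by intersecting with GL, once S has inverses. *)
Lemma iota_imageE (S : set 'M[Lambda delta]_m) :
  (forall A, S A -> exists2 B, S B & A *m B = 1%:M) ->
  @GLval R (2 * m) @` iota_image S = iota @` S.
Proof.
move=> SV; apply/seteqP; split=> [_ [g Sg <-] //|_ [A SA <-]].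
have [B _ AB] := SV A SA.
have Au : iota A \in unitmx.
  by have [] := @mulmx1_unit _ _ (iota A) (iota B) _; rewrite // -iotaM AB iota1.
by exists (mkGL Au) => //; exists A.
Qed.

Lemma iota_image_group (S : set 'M[Lambda delta]_m) : S 1%:M ->
  (forall A B, S A -> S B -> S (A *m B)) ->
  (forall A, S A -> exists2 B, S B & A *m B = 1%:M) ->
  group_closed (mem (iota_image S)).
Proof.
move=> S1 SM SV; split.
  by rewrite inE; exists 1%:M => //; rewrite iota1.
move=> g h; rewrite !inE => -[A SA Ag] [B SB Bh].
have [C SC BC] := SV B SB; exists (A *m C); first exact: SM.
rewrite iotaM Ag; congr (_ *m _).
have : GLval h *m iota C = 1%:M by rewrite -Bh -iotaM BC iota1.
move/(congr1 (mulmx (invmx (GLval h)))).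
by rewrite mulKmx ?GLvalP // mulmx1.
Qed.

End Iota.

Section Closedness.
Variables (R : realType) (delta : R) (T : topologicalType).

Definition ctsL (f : T -> Lambda delta) :=
  continuous (fun t => Re (f t)) /\ continuous (fun t => Im (f t)).

Lemma ctsL_cst u : ctsL (fun=> u).
Proof. by split; move=> t; exact: cvg_cst. Qed.

Lemma ctsLD f g : ctsL f -> ctsL g -> ctsL (fun t => f t + g t).
Proof.
move=> [f0 f1] [g0 g1]; split=> t.
  under eq_fun do rewrite ReD.
  by apply: cvgD; [exact: f0|exact: g0].
under eq_fun do rewrite ImD.
by apply: cvgD; [exact: f1|exact: g1].
Qed.

Lemma ctsLM f g : ctsL f -> ctsL g -> ctsL (fun t => f t * g t).
Proof.
move=> [f0 f1] [g0 g1]; split=> t.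
  under eq_fun do rewrite ReM.
  by apply: cvgD; [|apply: cvgM; [exact: cvg_cst|]]; apply: cvgM;
    by [exact: f0|exact: g0|exact: f1|exact: g1].
under eq_fun do rewrite ImM.
by apply: cvgD; apply: cvgM; by [exact: f0|exact: g0|exact: f1|exact: g1].
Qed.

Lemma ctsL_conj f : ctsL f -> ctsL (fun t => lconj (f t)).
Proof.
move=> [f0 f1]; split=> t.
  by under eq_fun do rewrite Re_conj; exact: f0.
by under eq_fun do rewrite Im_conj; apply: cvgN; exact: f1.
Qed.

Lemma ctsL_sum I (r : seq I) (F : I -> T -> Lambda delta) :
  (forall i, ctsL (F i)) -> ctsL (fun t => \sum_(i <- r) F i t).
Proof.
move=> cF; elim: r => [|i r IH].
  by under eq_fun do rewrite big_nil; exact: ctsL_cst.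
by under eq_fun do rewrite big_cons; exact: ctsLD.
Qed.

Definition ctsMx m n (F : T -> 'M[Lambda delta]_(m, n)) :=
  forall i j, ctsL (fun t => F t i j).

Lemma ctsMx_cst m n (A : 'M[Lambda delta]_(m, n)) : ctsMx (fun=> A).
Proof. by move=> i j; exact: ctsL_cst. Qed.

Lemma ctsMxM m n p (F : T -> 'M[Lambda delta]_(m, n))
    (G : T -> 'M[Lambda delta]_(n, p)) :
  ctsMx F -> ctsMx G -> ctsMx (fun t => F t *m G t).
Proof.
move=> cF cG i j; under eq_fun do rewrite mxE.
by apply: ctsL_sum => k; exact: ctsLM.
Qed.

Lemma ctsMx_dagger m n (F : T -> 'M[Lambda delta]_(m, n)) :
  ctsMx F -> ctsMx (fun t => dagger (F t)).
Proof.
by move=> cF i j; under eq_fun do rewrite !mxE; exact/ctsL_conj/cF.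
Qed.

Lemma ctsMx_ulsub m1 m2 n1 n2 (F : T -> 'M[Lambda delta]_(m1 + m2, n1 + n2)) :
  ctsMx F -> ctsMx (fun t => ulsubmx (F t)).
Proof. by move=> cF i j; under eq_fun do rewrite !mxE; exact: cF. Qed.

Lemma ctsMx_ursub m1 m2 n1 n2 (F : T -> 'M[Lambda delta]_(m1 + m2, n1 + n2)) :
  ctsMx F -> ctsMx (fun t => ursubmx (F t)).
Proof. by move=> cF i j; under eq_fun do rewrite !mxE; exact: cF. Qed.

Lemma ctsMx_dlsub m1 m2 n1 n2 (F : T -> 'M[Lambda delta]_(m1 + m2, n1 + n2)) :
  ctsMx F -> ctsMx (fun t => dlsubmx (F t)).
Proof. by move=> cF i j; under eq_fun do rewrite !mxE; exact: cF. Qed.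

Lemma ctsMx_drsub m1 m2 n1 n2 (F : T -> 'M[Lambda delta]_(m1 + m2, n1 + n2)) :
  ctsMx F -> ctsMx (fun t => drsubmx (F t)).
Proof. by move=> cF i j; under eq_fun do rewrite !mxE; exact: cF. Qed.

Lemma continuous_mull (a : R) (f : T -> R) :
  continuous f -> continuous (fun t => a * f t).
Proof. by move=> cf t; apply: cvgM; [exact: cvg_cst|exact: cf]. Qed.

Lemma closed_eqR (f g : T -> R) : continuous f -> continuous g ->
  closed [set t | f t = g t].
Proof.
move=> cf cg.
have -> : [set t | f t = g t] = (fun t => f t - g t) @^-1` [set 0].
  by apply/seteqP; split=> t /= => [->|/eqP]; rewrite ?subrr // subr_eq0 => /eqP.
apply: preimage_closed; last exact: closed_eq.
by move=> t _; apply: cvgB; [exact: cf|exact: cg].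
Qed.

Lemma closed_eqMx m n (F G : T -> 'M[Lambda delta]_(m, n)) :
  ctsMx F -> ctsMx G -> closed [set t | F t = G t].
Proof.
move=> cF cG.
have -> : [set t | F t = G t] = \bigcap_(ij in [set: 'I_m * 'I_n])
   ([set t | Re (F t ij.1 ij.2) = Re (G t ij.1 ij.2)] `&`
    [set t | Im (F t ij.1 ij.2) = Im (G t ij.1 ij.2)]).
  apply/seteqP; split=> t /= => [e ij _|e]; first by rewrite /= e.
  apply/matrixP => i j.
  by have [] := e (i, j) I; exact: lambda_inj.
apply: closed_bigI => ij _; have [F0 F1] := cF ij.1 ij.2.
by have [G0 G1] := cG ij.1 ij.2; apply: closedI; exact: closed_eqR.
Qed.

End Closedness.

Section Images.
Variables (R : realType) (delta : R).

Lemma ctsMx_iota_inv m : ctsMx (@iota_inv R delta m).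
Proof.
move=> i j; split; under eq_fun do rewrite mxE !lambdaS mulr1 mulr0 ?addr0 ?add0r;
  exact: coord_continuous.
Qed.

Lemma iota_image_closed m (S : set 'M[Lambda delta]_m) :
  closed [set M | S (iota_inv delta M)] -> closed (iota_image S).
Proof.
move=> cS.
have -> : iota_image S = @GLval R (2 * m) @^-1`
    ([set M | S (iota_inv delta M)] `&`
     \bigcap_(pq in [set: 'I_(2 * m) * 'I_(2 * m)])
       [set M | iota (iota_inv delta M) pq.1 pq.2 = M pq.1 pq.2]).
  apply/seteqP; split=> g /=.
    by move=> [A SA <-]; rewrite iotaK; split=> // pq _ /=; rewrite iotaK.
  move=> [Sg e]; exists (iota_inv delta (GLval g)) => //.
  by apply/matrixP => p q; exact: (e (p, q)).
apply: preimage_closed => [g _|]; first exact: GLval_continuous.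
apply: closedI => //; apply: closed_bigI => -[p q] _ /=.
apply: closed_eqR; last exact: coord_continuous.
under eq_fun do rewrite mxE /iota_block.
have [c0 c1] := @ctsMx_iota_inv m (blk p) (blk q).
have c2 : continuous
    (fun M => delta * Im (iota_inv delta M (blk p) (blk q))).
  exact: continuous_mull.
by case: (odd p); case: (odd q); [exact: c0|exact: c1|exact: c2|exact: c0].
Qed.

Lemma Qform2 n : Qform delta n *m Qform delta n = 1%:M.
Proof.
rewrite /Qform mulmx_block !mulmx0 !mul0mx !mul1mx !addr0 !add0r.
by rewrite mulNmx mulmxN opprK mul1mx -scalar_mx_block.
Qed.

Lemma dagger_Q n : dagger (Qform delta n) = Qform delta n.
Proof.
rewrite /dagger /Qform map_block_mx tr_block_mx !map_mx0 !trmx0.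
by rewrite map_mxN !map_mx1 linearN /= !trmx1.
Qed.

Lemma unitary_n1_inv n (A : 'M[Lambda delta]_(n + 1)) : unitary_n1 delta n A ->
  A *m (Qform delta n *m dagger A *m Qform delta n) = 1%:M.
Proof.
move=> UA; apply: mulmx1C.
by rewrite -!mulmxA [dagger A *m _]mulmxA UA Qform2.
Qed.

Lemma unitary_n1_V n (A : 'M[Lambda delta]_(n + 1)) : unitary_n1 delta n A ->
  exists2 B, unitary_n1 delta n B & A *m B = 1%:M.
Proof.
move=> UA.
exists (Qform delta n *m dagger A *m Qform delta n); last first.
  exact: unitary_n1_inv.
rewrite /unitary_n1 /= !dagger_mul daggerK dagger_Q.
rewrite -!mulmxA [Qform delta n *m (Qform delta n *m _)]mulmxA Qform2 mul1mx.
rewrite [A *m _]mulmxA [_ *m (dagger A *m _)]mulmxA -[A *m _ *m _]mulmxA.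
rewrite -[RHS]mulmx1 ; congr (_ *m _).
by rewrite -(unitary_n1_inv UA) !mulmxA.
Qed.

Lemma iota_unitary_n1_group n :
  group_closed (mem (iota_image (unitary_n1 delta n))).
Proof.
apply: iota_image_group => [|A B UA UB|A UA].
- by rewrite /unitary_n1 /= dagger1 mul1mx mulmx1.
- rewrite /unitary_n1 /= dagger_mul -!mulmxA [dagger A *m _]mulmxA.
  by rewrite [_ *m (A *m B)]mulmxA UA mulmxA.
- exact: unitary_n1_V.
Qed.

Lemma iota_unitary_n1_closed n : closed (iota_image (unitary_n1 delta n)).
Proof.
apply: iota_image_closed; apply: closed_eqMx; last exact: ctsMx_cst.
have c := @ctsMx_iota_inv (n + 1).
by apply: ctsMxM => //; apply: ctsMxM; [exact: ctsMx_dagger|exact: ctsMx_cst].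
Qed.

Lemma unitary_mul n (A B : 'M[Lambda delta]_n) :
  unitary delta n A -> unitary delta n B -> unitary delta n (A *m B).
Proof.
rewrite /unitary /= => UA UB.
by rewrite dagger_mul -mulmxA [dagger A *m _]mulmxA UA mul1mx.
Qed.

Lemma unitary_dagger n (A : 'M[Lambda delta]_n) :
  unitary delta n A -> unitary delta n (dagger A).
Proof. by move=> UA; rewrite /unitary /= daggerK; exact: mulmx1C. Qed.

Lemma USt_V n (A : 'M[Lambda delta]_(n + 1)) : USt delta n A ->
  exists2 B, USt delta n B & A *m B = 1%:M.
Proof.
move: A => _ [B UB [u Uu <-]].
exists (block_mx (dagger B) 0 0 (lconj u)%:M).
  exists (dagger B); first exact: unitary_dagger.
  by exists (lconj u) => //; rewrite /unitary1 /= lconjK mulrC.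
rewrite mulmx_block !mulmx0 !mul0mx !addr0 !add0r -scalar_mxM.
by rewrite (Uu : _ * _ = _) (mulmx1C UB) -scalar_mx_block.
Qed.

Lemma iota_USt_group n : group_closed (mem (iota_image (USt delta n))).
Proof.
apply: iota_image_group.
- exists 1%:M; first by rewrite /unitary /= dagger1 mulmx1.
  exists 1; first by rewrite /unitary1 /= rmorph1 mulr1.
  by rewrite -scalar_mx_block.
- move=> _ _ [B UB [u Uu <-]] [C UC [v Uv <-]].
  exists (B *m C); first exact: unitary_mul.
  exists (u * v).
    rewrite /unitary1 /= rmorphM /= mulrACA.
    by rewrite (Uu : _ * _ = _) (Uv : _ * _ = _) mulr1.
  by rewrite mulmx_block !mulmx0 !mul0mx !addr0 !add0r scalar_mxM.
- exact: USt_V.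
Qed.

Lemma UStP n (A : 'M[Lambda delta]_(n + 1)) : USt delta n A <->
  [/\ ursubmx A = 0, dlsubmx A = 0, unitary delta n (ulsubmx A) &
      unitary delta 1 (drsubmx A)].
Proof.
have U1 u : unitary delta 1 (u%:M : 'M[Lambda delta]_1) <-> unitary1 delta u.
  rewrite /unitary /unitary1 /= /dagger map_scalar_mx tr_scalar_mx -scalar_mxM.
  rewrite mulrC; split => [/matrixP/(_ 0 0)|-> //].
  by rewrite !mxE eqxx !mulr1n.
split=> [[B UB [u Uu <-]]|[e1 e2 UB Uu]].
  rewrite block_mxKur block_mxKdl block_mxKul block_mxKdr; split=> //.
  exact/U1.
exists (ulsubmx A) => //; exists (drsubmx A 0 0).
  by apply/U1; rewrite -mx11_scalar.
by rewrite -mx11_scalar -[in RHS](submxK A) e1 e2.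
Qed.

Lemma iota_USt_closed n : closed (iota_image (USt delta n)).
Proof.
apply: iota_image_closed.
have c := @ctsMx_iota_inv (n + 1).
have -> : [set M | USt delta n (iota_inv delta M)] =
    [set M | ursubmx (iota_inv delta M) = 0] `&`
    [set M | dlsubmx (iota_inv delta M) = 0] `&`
    [set M | unitary delta n (ulsubmx (iota_inv delta M))] `&`
    [set M | unitary delta 1 (drsubmx (iota_inv delta M))].
  by apply/seteqP; split=> M /= => [/UStP[]//|[[[? ?] ?] ?]]; apply/UStP.
repeat apply: closedI; apply: closed_eqMx; try exact: ctsMx_cst.
- exact: ctsMx_ursub.
- exact: ctsMx_dlsub.
- by apply: ctsMxM; first apply: ctsMx_dagger; exact: ctsMx_ulsub.
- by apply: ctsMxM; first apply: ctsMx_dagger; exact: ctsMx_drsub.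
Qed.

(* GL(2n+2; R) appears as GL R (2 * (n + 1)). *)
Definition iota_unitary n : chabauty (GL R (2 * (n + 1))) :=
  Chabauty (@iota_unitary_n1_closed n) (iota_unitary_n1_group n).

Definition iota_USt n : chabauty (GL R (2 * (n + 1))) :=
  Chabauty (@iota_USt_closed n) (iota_USt_group n).

Lemma iota_unitaryE n :
  @GLval R _ @` iota_unitary n = @iota R delta _ @` unitary_n1 delta n.
Proof. by apply: iota_imageE => A; exact: unitary_n1_V. Qed.

Lemma iota_UStE n :
  @GLval R _ @` iota_USt n = @iota R delta _ @` USt delta n.
Proof. by apply: iota_imageE => A; exact: USt_V. Qed.

End Images.

(* Main.v *)
Require Import Defs.
From mathcomp Require Import all_boot all_order all_algebra.
From mathcomp Require Import all_classical all_reals all_analysis.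
Set Implicit Arguments.
Unset Strict Implicit.
Unset Printing Implicit Defensive.
Import Order.TTheory GRing.Theory Num.Theory numFieldNormedType.Exports.
(* Re and Im are those of Lambda delta, not those of a closed field. *)
Import Defs.
Local Open Scope classical_set_scope.
Local Open Scope ring_scope.

(** Chabauty continuity at a parameter delta0 amounts to two semicontinuities:
    a group that misses a compact set still misses it for delta near delta0,
    and a group that meets an open set still meets it (chabauty_cvg).

    The first holds because the groups are cut out by equations that are
    polynomial jointly in delta and in the matrix: the pairs (g, delta) with g
    outside the group at delta form an open set, and compactness makes the
    neighbourhood of delta0 uniform in g.

    The second asks to deform an isometry A0 over Lambda delta0, of a
    nondegenerate real diagonal form D, into isometries of D over nearby
    Lambda delta.  Keeping the real coordinates of A0 while changing delta
    gives a family B whose Gram matrix dagger B *m D *m B is Hermitian and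
    tends to D.  A Hermitian matrix H close to D can be brought back to D by a
    congruence close to the identity (cholesky): each step of Gaussian
    elimination inverts a diagonal entry of H only, and this entry is a real
    number near a nonzero entry of D, because a self-conjugate element of
    Lambda delta is real.  Hence the same argument works for every sign of
    delta, although Lambda delta may have zero divisors or nilpotents.
    Correcting B by this congruence gives the isometries (isometry_lift).

    The stabilizer of the base point consists of the isometries that send
    the last basis vector to a unitary multiple of itself; invariance of the
    form then makes the last row vanish off the diagonal too. *)
(** * Convergence in the Chabauty space *)

(** A neighbourhood of H contains a finite intersection of subbasic sets around
    H, so only the two kinds of subbasic sets have to be tested. *)
Lemma chabauty_cvg (G : topGroupBaseType) (T : Type) (F : set_system T)
    (f : T -> chabauty G) (H : chabauty G) : Filter F ->
  (forall U, open U -> H `&` U !=set0 ->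
    \forall t \near F, f t `&` U !=set0) ->
  (forall K, compact K -> H `&` K = set0 ->
    \forall t \near F, f t `&` K = set0) ->
  f @ F --> H.
Proof.
move=> FF meet miss A; rewrite nbhsE => -[_ [[B sB <-] [C BC CH]] sUA].
rewrite nbhs_filterE; apply: filterS sUA _; apply: (@filterS _ _ _ C).
  by move=> ? ?; exists C.
have /sB [D sD IDeC] := BC; rewrite -IDeC.
apply: filter_bigI => E' DE.
have /sD := DE; have HE : E' H by move: CH; rewrite -IDeC => /(_ _ DE).
rewrite inE => -[[U oU UE]|[K cK KE]].
  by move: HE; rewrite -UE => HE; exact: meet.
by move: HE; rewrite -KE => HE; exact: miss.
Qed.

(** * The conjugate transpose *)

Definition embed_mx (R : realType) (delta : R) m n (M : 'M[R]_(m, n)) :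
    'M[Lambda delta]_(m, n) :=
  map_mx (GRing.in_alg (Lambda delta)) M.
Arguments embed_mx {R} delta {m n} M.

Section Dagger.
Variables (R : realType) (delta : R).

Lemma lconj_real (a : R) : lconj (a%:A : Lambda delta) = a%:A.
Proof.
by apply: lambda_inj; rewrite ?(Re_conj, Im_conj) !lambdaS ?mulr0 ?oppr0.
Qed.

(** This is what keeps the pivots of Hermitian matrices in R. *)
Lemma lconj_fixed (u : Lambda delta) : lconj u = u -> u = (Re u)%:A.
Proof.
move=> e; have Im0u : Im u = 0.
  apply/eqP; rewrite -[_ == 0](mulrn_eq0 _ 2) mulr2n; apply/eqP.
  by rewrite -{1}e Im_conj addNr.
by rewrite {1}(lambdaE u) Im0u scale0r addr0.
Qed.

Lemma dagger_block m1 m2 n1 n2 (A : 'M[Lambda delta]_(m1, n1))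
    (B : 'M[Lambda delta]_(m1, n2)) (C : 'M[Lambda delta]_(m2, n1))
    (D : 'M[Lambda delta]_(m2, n2)) :
  dagger (block_mx A B C D) =
  block_mx (dagger A) (dagger C) (dagger B) (dagger D).
Proof. by rewrite /dagger map_block_mx tr_block_mx. Qed.

Lemma dagger0 m n : dagger (0 : 'M[Lambda delta]_(m, n)) = 0.
Proof. by rewrite /dagger map_mx0 trmx0. Qed.

Lemma daggerD m n (A B : 'M[Lambda delta]_(m, n)) :
  dagger (A + B) = dagger A + dagger B.
Proof. by rewrite /dagger map_mxD linearD. Qed.

Lemma daggerZ m n (a : R) (A : 'M[Lambda delta]_(m, n)) :
  dagger (a%:A *: A) = a%:A *: dagger A.
Proof. by rewrite /dagger map_mxZ linearZ /= lconj_real. Qed.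

Lemma dagger_scalar n (u : Lambda delta) :
  dagger (u%:M : 'M[Lambda delta]_n) = (lconj u)%:M.
Proof. by rewrite /dagger map_scalar_mx tr_scalar_mx. Qed.

Lemma real_scalarM (a b : R) : a%:A * b%:A = (a * b)%:A :> Lambda delta.
Proof. by rewrite -scalerAl mul1r scalerA. Qed.

Lemma dagger_embed m n (M : 'M[R]_(m, n)) :
  dagger (embed_mx delta M) = embed_mx delta M^T.
Proof. by apply/matrixP => i j; rewrite !mxE /= lconj_real. Qed.

Lemma hermitian_block m (H : 'M[Lambda delta]_(1 + m)) :
  dagger H = H ->
  H = block_mx ((Re (ulsubmx H 0 0))%:A)%:M (dagger (dlsubmx H))
        (dlsubmx H) (drsubmx H) /\ dagger (drsubmx H) = drsubmx H.
Proof.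
move=> hH; have := hH; rewrite -{1}(submxK H) dagger_block.
rewrite -{5}(submxK H) => /eq_block_mx[eul edl _ edr]; split=> //.
rewrite -{1}(submxK H) edl; congr block_mx.
rewrite -lconj_fixed; first exact: mx11_scalar.
by rewrite -[in RHS]eul !mxE.
Qed.

End Dagger.

(** * Continuous families of matrices over a varying algebra *)

Lemma near_neq (R : realType) (T : topologicalType) (t0 : T) (f g : T -> R) :
  continuous_at t0 f -> continuous_at t0 g -> f t0 <> g t0 ->
  \forall t \near t0, f t <> g t.
Proof.
move=> cf cg /eqP; rewrite -subr_eq0 => n0.
near=> t => /eqP; rewrite -subr_eq0; apply/negP.
near: t; exact: cvgr_neq0 (cvgB cf cg) n0.
Unshelve. all: by end_near.
Qed.

Lemma cvg_mx (R : realType) (T : topologicalType) (t0 : T) m n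
    (M : T -> 'M[R]_(m, n)) :
  (forall i j, continuous_at t0 (fun t => M t i j)) ->
  continuous_at t0 M.
Proof.
move=> cM A [P MP sPA].
rewrite nbhs_filterE.
have : \forall t \near t0, forall i j, P i j (M t i j).
  apply: filter_forall => i; apply: filter_forall => j; exact/cM/MP.
by apply: filterS => t; exact: sPA.
Qed.

Section Families.
Variables (R : realType) (T : topologicalType) (dl : T -> R) (t0 : T).
Hypothesis dl_cont : continuous_at t0 dl.

(** The type of u t depends on t, so there is no topology in which u itself
    could be continuous; its two real coordinates are compared instead. *)
Definition ctsF (u : forall t, Lambda (dl t)) :=
  continuous_at t0 (fun t => Re (u t)) /\
  continuous_at t0 (fun t => Im (u t)).

Definition ctsFmx m n (A : forall t, 'M[Lambda (dl t)]_(m, n)) :=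
  forall i j, ctsF (fun t => A t i j).

Lemma ctsF_lin (a b : T -> R) :
  continuous_at t0 a -> continuous_at t0 b ->
  ctsF (fun t => a t *: 1 + b t *: 'qX).
Proof.
move=> ca cb; split.
  by under eq_fun do rewrite !lambdaS mulr1 mulr0 addr0.
by under eq_fun do rewrite !lambdaS mulr1 mulr0 add0r.
Qed.

Lemma ctsF_real (a : T -> R) : continuous_at t0 a ->
  ctsF (fun t => (a t)%:A).
Proof.
move=> ca; split.
  by under eq_fun do rewrite !lambdaS mulr1.
by under eq_fun do rewrite !lambdaS mulr0; exact: cvg_cst.
Qed.

Lemma ctsFD u v : ctsF u -> ctsF v -> ctsF (fun t => u t + v t).
Proof.
move=> [u0 u1] [v0 v1]; split.
  under eq_fun do rewrite ReD.
  by apply: cvgD.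
under eq_fun do rewrite ImD.
by apply: cvgD.
Qed.

Lemma ctsFM u v : ctsF u -> ctsF v -> ctsF (fun t => u t * v t).
Proof.
move=> [u0 u1] [v0 v1]; split.
  under eq_fun do rewrite ReM.
  by apply: cvgD; [|apply: cvgM => //]; exact: cvgM.
under eq_fun do rewrite ImM.
by apply: cvgD; exact: cvgM.
Qed.

Lemma ctsF_conj u : ctsF u -> ctsF (fun t => lconj (u t)).
Proof.
move=> [u0 u1]; split.
  by under eq_fun do rewrite Re_conj.
by under eq_fun do rewrite Im_conj; exact: cvgN.
Qed.

Lemma ctsF_sum I (r : seq I) (F : I -> forall t, Lambda (dl t)) :
  (forall i, ctsF (F i)) -> ctsF (fun t => \sum_(i <- r) F i t).
Proof.
move=> cF; elim: r => [|i r [IH0 IH1]].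
  split; first by under eq_fun do rewrite big_nil Re0; exact: cvg_cst.
  by under eq_fun do rewrite big_nil Im0; exact: cvg_cst.
have [c0 c1] := cF i; split.
  by under eq_fun do rewrite big_cons ReD; exact: cvgD.
by under eq_fun do rewrite big_cons ImD; exact: cvgD.
Qed.

Lemma ctsF_ext (u v : forall t, Lambda (dl t)) :
  (forall t, u t = v t) -> ctsF u -> ctsF v.
Proof.
by move=> e [c0 c1]; split; under eq_fun do rewrite -e.
Qed.

Lemma ctsFmx_ext m n (A B : forall t, 'M[Lambda (dl t)]_(m, n)) :
  (forall t, A t = B t) -> ctsFmx A -> ctsFmx B.
Proof.
by move=> e cA i j; apply: ctsF_ext (cA i j) => t; rewrite e.
Qed.

Lemma ctsFmxM m n p (A : forall t, 'M[Lambda (dl t)]_(m, n))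
    (B : forall t, 'M[Lambda (dl t)]_(n, p)) :
  ctsFmx A -> ctsFmx B -> ctsFmx (fun t => A t *m B t).
Proof.
move=> cA cB i j.
apply: (@ctsF_ext (fun t => \sum_k A t i k * B t k j)) => [t|].
  by rewrite mxE.
by apply: ctsF_sum => k; exact: ctsFM.
Qed.

Lemma ctsFmx_dagger m n (A : forall t, 'M[Lambda (dl t)]_(m, n)) :
  ctsFmx A -> ctsFmx (fun t => dagger (A t)).
Proof.
move=> cA i j; apply: (@ctsF_ext (fun t => lconj (A t j i))) => [t|].
  by rewrite !mxE.
exact: ctsF_conj.
Qed.

Lemma ctsFmxD m n (A B : forall t, 'M[Lambda (dl t)]_(m, n)) :
  ctsFmx A -> ctsFmx B -> ctsFmx (fun t => A t + B t).
Proof.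
move=> cA cB i j; apply: (@ctsF_ext (fun t => A t i j + B t i j)) => [t|].
  by rewrite mxE.
exact: ctsFD.
Qed.

Lemma ctsFmxZ m n (a : T -> R) (A : forall t, 'M[Lambda (dl t)]_(m, n)) :
  continuous_at t0 a -> ctsFmx A -> ctsFmx (fun t => (a t)%:A *: A t).
Proof.
move=> ca cA i j; apply: (@ctsF_ext (fun t => (a t)%:A * A t i j)) => [t|].
  by rewrite mxE.
by apply: ctsFM => //; exact: ctsF_real.
Qed.

Lemma ctsFmx_embed m n (M : 'M[R]_(m, n)) :
  ctsFmx (fun t => embed_mx (dl t) M).
Proof.
move=> i j; apply: (@ctsF_ext (fun t => (M i j)%:A)) => [t|].
  by rewrite mxE.
by apply: ctsF_real; exact: cvg_cst.
Qed.

Lemma ctsFmx_scalar n (a : T -> R) : continuous_at t0 a ->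
  ctsFmx (fun t => ((a t)%:A)%:M : 'M[Lambda (dl t)]_n).
Proof.
move=> ca; apply: ctsFmx_ext (ctsFmxZ ca (@ctsFmx_embed n n 1%:M)) => t.
by rewrite /embed_mx map_mx1 scalemx1.
Qed.

Lemma ctsFmx_block m1 m2 n1 n2 (A : forall t, 'M[Lambda (dl t)]_(m1, n1))
    (B : forall t, 'M[Lambda (dl t)]_(m1, n2))
    (C : forall t, 'M[Lambda (dl t)]_(m2, n1))
    (D : forall t, 'M[Lambda (dl t)]_(m2, n2)) :
  ctsFmx A -> ctsFmx B -> ctsFmx C -> ctsFmx D ->
  ctsFmx (fun t => block_mx (A t) (B t) (C t) (D t)).
Proof.
move=> cA cB cC cD i j.
by case: (split_ordP i) => i' ->; case: (split_ordP j) => j' ->;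
  [apply: ctsF_ext (cA i' j') => t; rewrite block_mxEul
  |apply: ctsF_ext (cB i' j') => t; rewrite block_mxEur
  |apply: ctsF_ext (cC i' j') => t; rewrite block_mxEdl
  |apply: ctsF_ext (cD i' j') => t; rewrite block_mxEdr].
Qed.

Lemma ctsFmx_ulsub m1 m2 n1 n2
    (A : forall t, 'M[Lambda (dl t)]_(m1 + m2, n1 + n2)) :
  ctsFmx A -> ctsFmx (fun t => ulsubmx (A t)).
Proof.
by move=> cA i j; apply: ctsF_ext (cA _ _) => t; rewrite !mxE.
Qed.

Lemma ctsFmx_ursub m1 m2 n1 n2
    (A : forall t, 'M[Lambda (dl t)]_(m1 + m2, n1 + n2)) :
  ctsFmx A -> ctsFmx (fun t => ursubmx (A t)).
Proof.
by move=> cA i j; apply: ctsF_ext (cA _ _) => t; rewrite !mxE.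
Qed.

Lemma ctsFmx_dlsub m1 m2 n1 n2
    (A : forall t, 'M[Lambda (dl t)]_(m1 + m2, n1 + n2)) :
  ctsFmx A -> ctsFmx (fun t => dlsubmx (A t)).
Proof.
by move=> cA i j; apply: ctsF_ext (cA _ _) => t; rewrite !mxE.
Qed.

Lemma ctsFmx_drsub m1 m2 n1 n2
    (A : forall t, 'M[Lambda (dl t)]_(m1 + m2, n1 + n2)) :
  ctsFmx A -> ctsFmx (fun t => drsubmx (A t)).
Proof.
by move=> cA i j; apply: ctsF_ext (cA _ _) => t; rewrite !mxE.
Qed.

(** The closed conditions that cut out the groups are violated on open sets of
    parameters. *)
Lemma ctsFmx_neq m n (A B : forall t, 'M[Lambda (dl t)]_(m, n)) :
  ctsFmx A -> ctsFmx B -> A t0 <> B t0 -> \forall t \near t0, A t <> B t.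
Proof.
move=> cA cB neq.
have [[i j] nij] : exists ij : 'I_m * 'I_n,
    A t0 ij.1 ij.2 <> B t0 ij.1 ij.2.
  apply: contra_notP neq => /forallNP e; apply/matrixP => i j.
  exact: contrapT (e (i, j)).
have [A0 A1] := cA i j; have [B0 B1] := cB i j.
have [eRe|/(near_neq A0 B0)] := pselect (Re (A t0 i j) = Re (B t0 i j)).
  have /(near_neq A1 B1) : Im (A t0 i j) <> Im (B t0 i j).
    by move=> eIm; apply: nij; exact: lambda_inj.
  by apply: filterS => t + e; rewrite e.
by apply: filterS => t + e; rewrite e.
Qed.

Lemma ctsFmx_iota m (A : forall t, 'M[Lambda (dl t)]_m) :
  ctsFmx A -> continuous_at t0 (fun t => iota (A t)).
Proof.
move=> cA; apply: cvg_mx => p q.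
under eq_fun do rewrite mxE /iota_block.
have [c0 c1] := cA (blk p) (blk q).
by case: (odd p); case: (odd q) => //=; exact: cvgM.
Qed.

End Families.

(** * Diagonalization of Hermitian matrices near a diagonal one *)

(** One step of symmetric elimination: the pivot h is scaled by c, the rest of
    its row and column is cleared, and the congruence T acts on the Schur
    complement of h.  For a Hermitian matrix, v and Ts are the conjugate
    transposes of w and T. *)
Lemma cholesky_block (L : comPzRingType) n (h hi c : L) (v : 'rV[L]_n)
    (w : 'cV[L]_n) (H T Ts : 'M[L]_n) : hi * h = 1 ->
  block_mx c%:M 0 (- (hi *: (Ts *m w))) Ts *m block_mx h%:M v w H *m
    block_mx c%:M (- (hi *: (v *m T))) 0 T =
  block_mx (c * h * c)%:M 0 0 (Ts *m (H - hi *: (w *m v)) *m T).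
Proof.
move=> hih.
have -> : block_mx c%:M 0 (- (hi *: (Ts *m w))) Ts *m block_mx h%:M v w H =
    block_mx (c * h)%:M (c *: v) 0 (Ts *m (H - hi *: (w *m v))).
  rewrite mulmx_block !mul0mx !addr0 -scalar_mxM mul_scalar_mx.
  rewrite mul_mx_scalar scalerN scalerA [h * hi]mulrC hih scale1r addNr.
  by rewrite mulNmx -scalemxAl -mulmxA addrC mulmxBr -scalemxAr.
rewrite mulmx_block !mulmx0 !mul0mx !addr0 !add0r -scalar_mxM.
rewrite mul_scalar_mx scalerN scalerA -(mulrA c h hi) [h * hi]mulrC hih mulr1.
by rewrite -scalemxAl addNr.
Qed.

Section Cholesky.
Variables (R : realType) (T : topologicalType) (dl : T -> R) (t0 : T).
Hypothesis dl_cont : continuous_at t0 dl.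

(** Induction on the size.  Since H t0 is diagonal, the pivot h t is near the
    first entry d1 of d, hence invertible, and the off-diagonal column w t tends
    to 0, so that the Schur complement S t tends to the rest of the diagonal.
    The square root of d1 / h t, which tends to 1, turns the pivot into d1. *)
Lemma cholesky m (d : 'rV[R]_m) (H : forall t, 'M[Lambda (dl t)]_m) :
  (forall i, d 0 i != 0) ->
  (forall t, dagger (H t) = H t) -> ctsFmx t0 H ->
  H t0 = embed_mx (dl t0) (diag_mx d) ->
  exists P : forall t, 'M[Lambda (dl t)]_m,
    [/\ ctsFmx t0 P, P t0 = 1%:M & \forall t \near t0,
        dagger (P t) *m H t *m P t = embed_mx (dl t) (diag_mx d)].
Proof.
elim: m d H => [|m IH] d H d0 hH cH Ht0.
  exists (fun t => 1%:M); split=> //; first by case.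
  by apply: nearW => t; apply/matrixP => -[].
have {}hH t := @hermitian_block _ _ m _ (hH t).
(* Block operations on H t need its size to be displayed as a sum. *)
rewrite -[m.+1]/(1 + m)%N in d H d0 hH cH Ht0 *.
pose d1 := lsubmx d 0 0; pose d2 := rsubmx d.
have Dblock delta : embed_mx delta (diag_mx d) =
    block_mx (d1%:A)%:M 0 0 (embed_mx delta (diag_mx d2)).
  rewrite -{1}(hsubmxK d) diag_mx_row /embed_mx map_block_mx !map_mx0.
  congr block_mx; rewrite [lsubmx d]mx11_scalar -/d1 map_diag_mx.
  by apply/matrixP => i j; rewrite !mxE !ord1.
have d1n0 : d1 != 0 by rewrite /d1 mxE.
pose h t := Re (ulsubmx (H t) 0 0); pose w t := dlsubmx (H t).
have HE t : H t = block_mx ((h t)%:A)%:M (dagger (w t)) (w t) (drsubmx (H t)).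
  by have [] := hH t.
have cw : ctsFmx t0 w by apply: ctsFmx_dlsub; exact: cH.
have ch : continuous_at t0 h by have [] := ctsFmx_ulsub cH 0 0.
move: (Ht0); rewrite HE Dblock => /eq_block_mx[ht0 _ wt0 H2t0].
have {}ht0 : h t0 = d1.
  move/matrixP/(_ 0 0): ht0 => /(congr1 (@Re _ _)).
  by rewrite !mxE !eqxx !lambdaS !mulr1.
have hn0 : h t0 != 0 by rewrite ht0.
have chi : continuous_at t0 (fun t => (h t)^-1) by exact: cvgV.
have chiN : continuous_at t0 (fun t => - (h t)^-1).
  by apply: (@cvgN R R) => //; exact: chi.
pose S t := drsubmx (H t) + (- (h t)^-1)%:A *: (w t *m dagger (w t)).
have [||||P [cP Pt0 PS]] := IH d2 S.
- by move=> i; rewrite mxE.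
- move=> t; have [_ e] := hH t.
  by rewrite daggerD e daggerZ dagger_mul daggerK.
- apply: ctsFmxD; first by apply: ctsFmx_drsub; exact: cH.
  apply: (ctsFmxZ dl_cont chiN).
  by apply: ctsFmxM => //; exact: ctsFmx_dagger.
- by rewrite /S wt0 mul0mx scaler0 addr0.
pose c t := Num.sqrt (d1 / h t).
have cc : continuous_at t0 c.
  apply: (@continuous_comp _ _ _ (fun t => d1 / h t));
    last exact: sqrt_continuous.
  by apply: cvgM => //; exact: cvg_cst.
have ct0 : c t0 = 1 by rewrite /c ht0 divff // sqrtr1.
exists (fun t => block_mx ((c t)%:A)%:M
  ((- (h t)^-1)%:A *: (dagger (w t) *m P t)) 0 (P t)); split.
- apply: ctsFmx_block => //; first exact: ctsFmx_scalar.
    apply: (ctsFmxZ dl_cont chiN).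
    by apply: ctsFmxM => //; exact: ctsFmx_dagger.
  apply: ctsFmx_ext (ctsFmx_embed _ _ (0 : 'M[R]_(m, 1))) => t.
  exact: map_mx0.
- by rewrite ct0 scale1r wt0 Pt0 dagger0 mul0mx scaler0 -scalar_mx_block.
near=> t.
have ht : h t != 0.
  by near: t; exact: cvgr_neq0 ch hn0.
have dh : 0 < d1 / h t.
  near: t; apply: (cvgr_gt (d1 / h t0)); last by rewrite ht0 divff.
  by apply: cvgM => //; exact: cvg_cst.
rewrite dagger_block dagger0 dagger_scalar lconj_real daggerZ dagger_mul.
rewrite daggerK [H t]HE !scaleNr cholesky_block; last first.
  by rewrite real_scalarM mulVf // scale1r.
rewrite Dblock; congr block_mx.
  rewrite !real_scalarM mulrAC -expr2 sqr_sqrtr ?ltW //.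
  by rewrite divfK.
have PSt : dagger (P t) *m S t *m P t = embed_mx (dl t) (diag_mx d2).
  by near: t.
by rewrite -PSt /S !scaleNr.
Unshelve. all: by end_near.
Qed.

End Cholesky.

(** * Chabauty continuity of a family of groups *)

(* Families indexed by the parameter delta itself. *)
Local Notation ctsFmx_id delta0 A :=
  (@ctsFmx _ _ (fun delta => delta) delta0 _ _ A).

Section Lifting.
Variable R : realType.

Lemma continuous_at_id (delta0 : R) : continuous_at delta0 (fun x => x).
Proof. exact: cvg_id. Qed.

(** The same real coordinates, read in another algebra. *)
Definition lift_mx (delta0 delta : R) m n (A : 'M[Lambda delta0]_(m, n)) :
    'M[Lambda delta]_(m, n) :=
  \matrix_(i, j) (Re (A i j) *: 1 + Im (A i j) *: 'qX).

Lemma lift_mx_id (delta0 : R) m n (A : 'M[Lambda delta0]_(m, n)) :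
  lift_mx delta0 A = A.
Proof. by apply/matrixP => i j; rewrite mxE -lambdaE. Qed.

Lemma ctsFmx_lift (delta0 : R) m n (A : 'M[Lambda delta0]_(m, n)) :
  ctsFmx_id delta0 (fun delta => lift_mx delta A).
Proof.
move=> i j.
apply: (@ctsF_ext _ _ (fun x => x) _
  (fun delta => Re (A i j) *: 1 + Im (A i j) *: 'qX)) => [delta|].
  by rewrite mxE.
by apply: (@ctsF_lin R R (fun x => x)); exact: cvg_cst.
Qed.

(** The family lift_mx delta A0 is isometric only at delta0; the congruence
    that brings its Gram matrix back to D repairs it nearby. *)
Lemma isometry_lift m (d : 'rV[R]_m) (delta0 : R) (A0 : 'M[Lambda delta0]_m) :
  (forall i, d 0 i != 0) ->
  dagger A0 *m embed_mx delta0 (diag_mx d) *m A0 =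
    embed_mx delta0 (diag_mx d) ->
  exists A : forall delta, 'M[Lambda delta]_m,
    [/\ ctsFmx_id delta0 A, A delta0 = A0 &
        \forall delta \near delta0,
          dagger (A delta) *m embed_mx delta (diag_mx d) *m A delta =
          embed_mx delta (diag_mx d)].
Proof.
move=> d0 UA.
pose B delta := lift_mx delta A0; pose D delta := embed_mx delta (diag_mx d).
have cid := @continuous_at_id delta0.
have cB : ctsFmx_id delta0 B by exact: ctsFmx_lift.
have [||||P [cP P0 nP]] := @cholesky R R (fun x => x) delta0 cid m d
    (fun delta => dagger (B delta) *m D delta *m B delta).
- exact: d0.
- by move=> delta; rewrite !dagger_mul daggerK dagger_embed tr_diag_mx mulmxA.
- apply: ctsFmxM => //; apply: ctsFmxM => //; last exact: ctsFmx_embed.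
  exact: ctsFmx_dagger.
- by rewrite /B lift_mx_id.
exists (fun delta => B delta *m P delta); split.
- exact: ctsFmxM.
- by rewrite P0 mulmx1 /B lift_mx_id.
- apply: filterS nP => delta; rewrite dagger_mul => e.
  by rewrite -[RHS]e !mulmxA.
Qed.

(** The third hypothesis, that members of the groups extend to continuous
    families of members, gives the part of the Chabauty topology about open
    sets; the last, that being outside the groups is an open condition, gives
    the part about compact sets.  The latter is stated for an arbitrary
    parameter space because it is applied to pairs of an invertible matrix and
    a parameter. *)
Lemma chabauty_continuous m (S : forall delta : R, set 'M[Lambda delta]_m)
    (c : R -> chabauty (GL R (2 * m))) :
  (forall delta, c delta = iota_image (S delta) :> set _) ->
  (forall delta, @GLval R (2 * m) @` iota_image (S delta) =
                 @iota R delta m @` S delta) ->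
  (forall (delta0 : R) A0, S delta0 A0 ->
    exists A : forall delta, 'M[Lambda delta]_m,
    [/\ ctsFmx_id delta0 A, A delta0 = A0 &
        \forall delta \near delta0, S delta (A delta)]) ->
  (forall (T : topologicalType) (dl : T -> R) (t0 : T)
      (A : forall t, 'M[Lambda (dl t)]_m),
    continuous_at t0 dl -> ctsFmx t0 A ->
    ~ S (dl t0) (A t0) -> \forall t \near t0, ~ S (dl t) (A t)) ->
  continuous c.
Proof.
move=> cE SE lift openS delta0; apply: chabauty_cvg.
  move=> U [V oV VU] [g []]; rewrite cE => -[A0 SA0 A0g] Ug.
  have [A [cA A0E nA]] := lift _ _ SA0.
  have VA0 : V (iota (A delta0)) by rewrite A0E A0g; move: Ug; rewrite -VU.
  have nV : \forall delta \near delta0, V (iota (A delta)).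
    have cid := @continuous_at_id delta0.
    exact: (@ctsFmx_iota R R (fun x => x) delta0 cid m A cA) (open_nbhs_nbhs _).
  near=> delta.
  have : (@iota R delta m @` S delta) (iota (A delta)).
    by exists (A delta) => //; near: delta.
  rewrite -SE => -[h Sh hE]; exists h; split; first by rewrite cE.
  have : V (GLval h) by rewrite hE; near: delta.
  by rewrite -VU.
move=> K cK cK0.
have nK : \forall delta \near delta0,
    K `<=` (fun g => ~ iota_image (S delta) g).
  have /compact_near_coveringP cover := cK.
  apply: (cover R (nbhs delta0) (fun delta g => ~ iota_image (S delta) g)).
  move=> g Kg.
  have ncg : ~ iota_image (S delta0) g.
    rewrite -cE => cg; have : (c delta0 `&` K) g by [].
    by rewrite cK0.
  pose A (t : GL R (2 * m) * R) := iota_inv t.2 (GLval t.1).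
  have csnd : continuous_at (g, delta0) (fun t : GL R (2 * m) * R => t.2).
    exact: cvg_snd.
  have cGL p q : continuous_at (g, delta0)
      (fun t : GL R (2 * m) * R => GLval t.1 p q).
    apply: (@continuous_comp _ _ _ (fun t : GL R (2 * m) * R => GLval t.1)
      (fun M : 'M[R]_(2 * m) => M p q)); last exact: coord_continuous.
    apply: (@continuous_comp _ _ _ (fun t : GL R (2 * m) * R => t.1)
      (@GLval R (2 * m))); last exact: GLval_continuous.
    exact: cvg_fst.
  have cA : @ctsFmx R _ (fun t : GL R (2 * m) * R => t.2) (g, delta0) m m A.
    move=> i j; apply: (@ctsF_ext _ _ (fun t : GL R (2 * m) * R => t.2) _
      (fun t => GLval t.1 (unblk i false) (unblk j false) *: 1 +
                GLval t.1 (unblk i true) (unblk j false) *: 'qX)) => [t|].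
      by rewrite mxE.
    by apply: (@ctsF_lin _ _ (fun t : GL R (2 * m) * R => t.2)).
  have notc (t : GL R (2 * m) * R) :
      ~ S t.2 (A t) \/ iota (A t) <> GLval t.1 -> ~ iota_image (S t.2) t.1.
    move=> nS [A' SA' A'E].
    have AE : A t = A' by rewrite /A -A'E iotaK.
    by case: nS; rewrite AE.
  (* g is outside the group either because its candidate preimage A violates
     the equations of the group, or because g is not in the image of iota. *)
  have [SA|nSA] := pselect (S delta0 (A (g, delta0))); last first.
    have := openS _ _ _ _ csnd cA nSA.
    by apply: filterS => -[g' delta] nS; apply: (notc (g', delta)); left.
  have [[p q] /= npq] : exists pq : 'I_(2 * m) * 'I_(2 * m),
      iota (A (g, delta0)) pq.1 pq.2 <> GLval g pq.1 pq.2.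
    apply: contra_notP ncg => /forallNP e.
    exists (A (g, delta0)) => //; apply/matrixP => p q.
    exact: contrapT (e (p, q)).
  have ciA : continuous_at (g, delta0) (fun t => iota (A t) p q).
    apply: (@continuous_comp _ _ _ (fun t => iota (A t))
      (fun M : 'M[R]_(2 * m) => M p q)); last exact: coord_continuous.
    exact: (@ctsFmx_iota _ _ (fun t : GL R (2 * m) * R => t.2)).
  have := near_neq ciA (cGL p q) npq.
  apply: filterS => -[g' delta] ne; apply: (notc (g', delta)); right => /= e.
  by apply: ne; rewrite /= e.
apply: filterS nK => delta Kc; apply/seteqP; split=> g //.
by rewrite cE => -[cg /Kc].
Unshelve. all: by end_near.
Qed.

End Lifting.

(** * The point stabilizer *)

Section Stabilizer.
Variables (R : realType) (delta : R).

Lemma base_in_hyperbolic_space n :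
  hyperbolic_space delta n (base_point delta n).
Proof.
exists (col_mx 0 1%:M) => //=.
rewrite /hyperboloid /= tr_col_mx trmx0 trmx1 map_col_mx map_mx0 map_mx1.
rewrite /Qform mul_row_block !mul0mx !mulmx0 !mul1mx !add0r.
by rewrite mul_row_col mul0mx add0r mulmx1.
Qed.

Lemma unitary1M (u v : Lambda delta) :
  unitary1 delta u -> unitary1 delta v -> unitary1 delta (u * v).
Proof.
rewrite /unitary1 /= => Uu Uv.
by rewrite rmorphM mulrACA Uu Uv mulr1.
Qed.

Lemma unitary1V (u : Lambda delta) :
  unitary1 delta u -> unitary1 delta (lconj u).
Proof. by rewrite /unitary1 /= lconjK mulrC. Qed.

Lemma dagger_Qform_block n (B : 'M[Lambda delta]_n) (b : 'cV[Lambda delta]_n)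
    (c : 'rV[Lambda delta]_n) (e : 'M[Lambda delta]_1) :
  dagger (block_mx B b c e) *m Qform delta n *m block_mx B b c e =
  block_mx (dagger B *m B - dagger c *m c) (dagger B *m b - dagger c *m e)
           (dagger b *m B - dagger e *m c) (dagger b *m b - dagger e *m e).
Proof.
rewrite dagger_block /Qform mulmx_block !mulmx1 !mulmx0 !addr0 !add0r.
by rewrite !mulmxN !mulmx1 mulmx_block !mulNmx.
Qed.

(** If A sends the last basis vector to a multiple u of itself, the off-diagonal
    block of the isometry equation reduces to the last row times the conjugate
    of u, and u is invertible. *)
Lemma USt_stabilizer n : USt delta n = stabilizer (base_point delta n).
Proof.
apply/seteqP; split=> [_ [B UB [u Uu <-]]|A [UA Ap]].
  split.
    rewrite /unitary_n1 /= dagger_Qform_block UB dagger_scalar.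
    rewrite -scalar_mxM [lconj u * u]mulrC (Uu : _ * _ = _).
    by rewrite !dagger0 !mulmx0 !mul0mx !subr0 sub0r.
  have img v : block_mx B 0 0 u%:M *m (v *: col_mx 0 1%:M) =
      (u * v) *: (col_mx 0 1%:M : 'cV[Lambda delta]_(n + 1)).
    rewrite -scalemxAr mul_block_col !mulmx0 mul0mx mulmx1 !add0r.
    by rewrite mulrC -scalerA [in RHS]scale_col_mx scaler0 scalemx1.
  apply/seteqP; split=> [_ [_ [v Uv <-] <-]|_ [v Uv <-]].
    by rewrite img; exists (u * v) => //; exact: unitary1M.
  exists ((lconj u * v) *: col_mx 0 1%:M).
    by exists (lconj u * v) => //; exact/unitary1M/Uv/unitary1V.
  by rewrite img mulrA (Uu : _ * _ = _) mul1r.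
have [u Uu Ae] : base_point delta n (A *m col_mx 0 1%:M).
  rewrite -Ap; exists (col_mx 0 1%:M) => //; exists 1; last exact: scale1r.
  by rewrite /unitary1 /= rmorph1 mulr1.
move: UA Ae; rewrite -(submxK A) /unitary_n1 /= mul_block_col.
rewrite !mulmx0 !add0r !mulmx1 scale_col_mx scaler0 scalemx1.
move=> UA /eq_col_mx[e1 e2].
move: UA; rewrite -e1 -e2.
rewrite dagger_Qform_block dagger0 mul0mx dagger_scalar.
move=> /eq_block_mx[+ _ + _].
(* The conjugate of u cancels against u. *)
rewrite sub0r => eB /(congr1 (fun X => u%:M *m - X)).
rewrite opprK oppr0 mulmx0 mulmxA -scalar_mxM (Uu : _ * _ = _) mul1mx => ec.
move: eB; rewrite ec mulmx0 subr0 => UB.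
by exists (ulsubmx A) => //; exists u.
Qed.

End Stabilizer.

(** * Continuity of the unitary groups and of the stabilizers *)

Section Continuity.
Variable R : realType.

Lemma Qform_embed (delta : R) n : Qform delta n =
  embed_mx delta (diag_mx (row_mx (const_mx 1) (const_mx (-1)))).
Proof.
rewrite diag_mx_row !diag_const_mx /embed_mx map_block_mx !map_mx0.
by rewrite map_scalar_mx /= scale1r map_scalar_mx /= scaleN1r /Qform raddfN.
Qed.

Lemma embed_mx1 (delta : R) n :
  1%:M = embed_mx delta (diag_mx (const_mx 1)) :> 'M[Lambda delta]_n.
Proof. by rewrite diag_const_mx /embed_mx map_mx1. Qed.

Lemma unitary_lift n (delta0 : R) (A0 : 'M[Lambda delta0]_n) :
  unitary delta0 n A0 ->
  exists A : forall delta, 'M[Lambda delta]_n,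
    [/\ ctsFmx_id delta0 A, A delta0 = A0 &
        \forall delta \near delta0, unitary delta n (A delta)].
Proof.
move=> UA; have [||A [cA AE nA]] := @isometry_lift R n (const_mx 1) delta0 A0.
- by move=> i; rewrite mxE oner_eq0.
- by rewrite -embed_mx1 mulmx1.
exists A; split=> //; apply: filterS nA => delta.
by rewrite -embed_mx1 mulmx1.
Qed.

Lemma unitary_continuous n : continuous (fun delta : R => iota_unitary delta n).
Proof.
apply: (@chabauty_continuous R _ (fun delta => unitary_n1 delta n)) => //.
- by move=> delta; exact: (iota_unitaryE delta n).
- move=> delta0 A0 UA.
  have [||A [cA AE nA]] := @isometry_lift R _
      (row_mx (const_mx 1) (const_mx (-1))) delta0 A0.
  + move=> i; case: (split_ordP i) => k ->.
      by rewrite row_mxEl mxE oner_eq0.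
    by rewrite row_mxEr mxE oppr_eq0 oner_eq0.
  + by rewrite -Qform_embed.
  exists A; split=> //; apply: filterS nA => delta.
  by rewrite -Qform_embed.
- move=> T dl t0 A cdl cA nU.
  have cQ : ctsFmx t0 (fun t => Qform (dl t) n).
    apply: ctsFmx_ext (ctsFmx_embed dl t0 _) => t.
    exact/esym/Qform_embed.
  apply: ctsFmx_neq nU => //.
  by apply: ctsFmxM => //; apply: ctsFmxM => //; exact: ctsFmx_dagger.
Qed.

Lemma USt_continuous n : continuous (fun delta : R => iota_USt delta n).
Proof.
apply: (@chabauty_continuous R _ (fun delta => USt delta n)) => //.
- by move=> delta; exact: (iota_UStE delta n).
- move=> delta0 A0 /UStP[ur0 dl0 /unitary_lift[B [cB BE nB]]
    /unitary_lift[C [cC CE nC]]].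
  exists (fun delta => block_mx (B delta) 0 0 (C delta)); split.
  + by apply: ctsFmx_block => //;
      apply: ctsFmx_ext (ctsFmx_embed _ _ 0) => delta; exact: map_mx0.
  + by rewrite BE CE -[RHS]submxK ur0 dl0.
  + near=> delta; apply/UStP; rewrite block_mxKur block_mxKdl block_mxKul.
    by rewrite block_mxKdr; split=> //; near: delta.
(* One of the four conditions of UStP fails at t0, and goes on failing. *)
- move=> T dl t0 A cdl cA nU.
  have nU1 k (B : forall t, 'M[Lambda (dl t)]_k) : ctsFmx t0 B ->
      ~ unitary (dl t0) k (B t0) ->
      \forall t \near t0, ~ unitary (dl t) k (B t).
    move=> cB; apply: ctsFmx_neq.
      by apply: ctsFmxM => //; exact: ctsFmx_dagger.
    by apply: ctsFmx_ext (ctsFmx_embed _ _ 1%:M) => t; exact: map_mx1.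
  have n0 k l (B : forall t, 'M[Lambda (dl t)]_(k, l)) : ctsFmx t0 B ->
      B t0 <> 0 -> \forall t \near t0, B t <> 0.
    move=> cB; apply: ctsFmx_neq => //.
    by apply: ctsFmx_ext (ctsFmx_embed _ _ 0) => t; exact: map_mx0.
  have [ur0|/(n0 _ _ _ (ctsFmx_ursub cA))] := pselect (ursubmx (A t0) = 0);
    last by apply: filterS => t + /UStP[].
  have [dl0|/(n0 _ _ _ (ctsFmx_dlsub cA))] := pselect (dlsubmx (A t0) = 0);
    last by apply: filterS => t + /UStP[].
  have [ul0|/(nU1 _ _ (ctsFmx_ulsub cA))] :=
    pselect (unitary (dl t0) n (ulsubmx (A t0)));
    last by apply: filterS => t + /UStP[].
  have [dr0|/(nU1 _ _ (ctsFmx_drsub cA))] :=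
    pselect (unitary (dl t0) 1 (drsubmx (A t0)));
    last by apply: filterS => t + /UStP[].
  by case: nU; apply/UStP.
Unshelve. all: by end_near.
Qed.

End Continuity.

Theorem mainTheorem12 (R : realType) (n : nat) :
  (forall delta : R,
     hyperbolic_space delta n (base_point delta n) /\
     USt delta n = stabilizer (base_point delta n)) /\
  continuous (fun delta : R => iota_unitary delta n) /\
  continuous (fun delta : R => iota_USt delta n).
Proof.
split; last by split; [exact: unitary_continuous|exact: USt_continuous].
by move=> delta; split; [exact: base_in_hyperbolic_space|exact: USt_stabilizer].
Qed.
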